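(* Let $D$ be an $r$-regular digraph with $r\geq 2$ and at least $8r^4$ vertices. Then $dib(D)=r+1$.
   Context: All digraphs are finite, loopless, and simple: $D=(V,A)$ where $A$ is a set of ordered pairs $uv$ (darts) of distinct vertices; both $uv$ and $vu$ may be darts. $D$ is $r$-regular if every vertex has exactly $r$ out-going darts and exactly $r$ in-coming darts. A coloring of $D$ with $k$ colors is a surjective map $\varsigma:V\to\{1,\dots,k\}$; it is acyclic if each color class induces a subdigraph with no directed cycle. With respect to $\varsigma$, a vertex $u$ is a $b^+$-vertex if for every color $j\neq\varsigma(u)$ there is a dart $uw$ with $\varsigma(w)=j$, and a $b^-$-vertex if for every color $j\neq \varsigma(u)$ there is a dart $wu$ with $\varsigma(w)=j$. A $b$-coloring is a coloring in which every color class contains a $b^+$-vertex and a $b^-$-vertex. The dib-chromatic number $dib(D)$ is the largest $k$ such that $D$ admits an acyclic $b$-coloring with $k$ colors. *)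

(* Defs.v *)
From mathcomp Require Import all_boot.

Set Implicit Arguments.
Unset Strict Implicit.
Unset Printing Implicit Defensive.

(* Simplicity is built in: [dart] is a relation, so there is at most one dart
   from u to v, while both (u, v) and (v, u) may be darts. *)
Record digraph := Digraph {
  vertex :> finType;
  dart : rel vertex;
  dart_irrefl : irreflexive dart
}.

Section Digraph.
Variable D : digraph.
Implicit Types u v w : D.

Definition outdeg u : nat := #|[set v : D | dart u v]|.
Definition indeg u : nat := #|[set v : D | dart v u]|.

Definition regular (r : nat) : Prop :=
  forall u, outdeg u = r /\ indeg u = r.

(* The vertices of [c] are pairwise distinct, and there are darts from each to
   the next and from the last to the first. Digons (size 2) count as directed
   cycles; size 1 is impossible by [dart_irrefl]. *)
Definition dicycle (c : seq D) : Prop :=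
  c != [::] /\ ucycle (@dart D) c.

Section Coloring.
Variables (k : nat) (f : D -> 'I_k).

Definition coloring : Prop := forall j, exists v, f v = j.

Definition acyclic_coloring : Prop :=
  forall j, ~ exists c, dicycle c /\ forall v, v \in c -> f v = j.

Definition bplus_vertex u : Prop :=
  forall j, j != f u -> exists w, dart u w /\ f w = j.

Definition bminus_vertex u : Prop :=
  forall j, j != f u -> exists w, dart w u /\ f w = j.

Definition b_coloring : Prop :=
  coloring /\
  forall j, (exists u, f u = j /\ bplus_vertex u) /\
            (exists u, f u = j /\ bminus_vertex u).

End Coloring.

Definition has_acyclic_b_coloring (k : nat) : Prop :=
  exists f : D -> 'I_k, b_coloring f /\ acyclic_coloring f.

(* [is_dib k] reads dib(D) = k; such a k is unique by antisymmetry of [<=]. *)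
Definition is_dib (k : nat) : Prop :=
  has_acyclic_b_coloring k /\
  forall k', has_acyclic_b_coloring k' -> k' <= k.

End Digraph.

(* Main.v *)
Require Import Defs.
From mathcomp Require Import all_boot.
From mathcomp Require Import perm zify.

Set Implicit Arguments.
Unset Strict Implicit.
Unset Printing Implicit Defensive.

(** Any acyclic partial colouring with [r + 1] colours extends greedily to all
    of [D]: a vertex has only [r] out-neighbours, so some colour makes it a sink
    of its class. Hence it suffices to plant, for each colour, one [b+]-vertex
    with a rainbow closed out-neighbourhood and one [b-]-vertex with a rainbow
    closed in-neighbourhood, keeping the classes acyclic. A new out-neighbourhood
    [N[x]] is safe when no vertex of [N[x]] is coloured or has a dart to a
    coloured vertex; each coloured vertex rules out at most [1 + r + r^2] choices
    of [x]. In-neighbourhoods are treated by reversing all darts. At most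
    [2 (r + 1)^2 (1 + r + r^2) < 8 r^4] vertices are ever excluded. *)

(** [cycle] allows repeated vertices, so closed walks are excluded. Every closed walk contains a
    directed cycle, so this is ordinary acyclicity without tracking distinctness. *)
Definition acyclic_on (T : eqType) (e : rel T) (P : pred T) : Prop :=
  forall c, c != [::] -> cycle e c -> ~~ all P c.

Lemma acyclic_on_rev (T : eqType) (e : rel T) (P : pred T) :
  acyclic_on e P -> acyclic_on (fun u v => e v u) P.
Proof.
move=> acP c c0 cyc; rewrite -all_rev; apply: acP; last by rewrite rev_cycle.
by rewrite -size_eq0 size_rev size_eq0.
Qed.

(** The class gains at most [x], a sink in it: on a closed walk through [x], the successor of [x]
    would be an out-neighbour of [x] in the class. *)
Lemma acyclic_on_add_sink (T : eqType) (e : rel T) (P Q : pred T) (x : T) :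
  acyclic_on e P -> (forall v, Q v -> v != x -> P v) ->
  ~~ e x x -> (forall v, P v -> ~~ e x v) -> acyclic_on e Q.
Proof.
move=> acP QP exx eP c c0 cyc; apply/negP => /allP allQ.
have [xc | xc] := boolP (x \in c).
  have exn := next_cycle cyc xc.
  have [nx | nx] := eqVneq (next c x) x; first by rewrite nx (negPf exx) in exn.
  have /QP/(_ nx)/eP : Q (next c x) by apply: allQ; rewrite mem_next.
  by rewrite exn.
have /negP := acP c c0 cyc; apply; apply/allP => v vc; apply: QP (allQ v vc) _.
by apply: contraNneq xc => <-.
Qed.

(** Number [A] by rank, then compose with the transposition that sends the rank of [x] to [i]. *)
Lemma rainbow_labelling (T : finType) (A : {set T}) (n : nat) (x : T) (i : 'I_n) :
  #|A| = n -> x \in A ->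
  exists h : T -> 'I_n, [/\ h x = i, {in A &, injective h} &
    forall j, exists2 w, w \in A & h w = j].
Proof.
move=> cA xA; case: _ / cA i => i.
pose rk := enum_rank_in xA.
have hj j : tperm (rk x) i (rk (enum_val (tperm (rk x) i j))) = j.
  by rewrite /rk enum_valK_in tpermK.
exists (fun v => tperm (rk x) i (rk v)); split.
- by rewrite tpermL.
- by move=> u v uA vA /perm_inj; apply: (can_in_inj (enum_rankK_in xA)).
- by move=> j; exists (enum_val (tperm (rk x) i j)); [exact: enum_valP | exact: hj].
Qed.

Lemma leq_card_bigcup (I T : finType) (A : {set I}) (F : I -> {set T}) (m : nat) :
  (forall i, #|F i| <= m) -> #|\bigcup_(i in A) F i| <= #|A| * m.
Proof.
move=> hF; rewrite -sum_nat_const.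
apply: (big_ind2 (fun (B : {set T}) n => #|B| <= n)) => [|B n C p Bn Cp|i _] //.
  by rewrite cards0.
by apply: leq_trans (leq_card_setU _ _) (leq_add Bn Cp).
Qed.

(** These [x] reach [s] by a walk of length at most 2; they are the centres that a coloured [s]
    rules out when planting. *)
Lemma card_two_step_predecessors (T : finType) (e : rel T) (r : nat) (s : T) :
  (forall u, #|[set v | e v u]| <= r) ->
  #|[set x | [exists y, ((y == x) || e x y) && ((y == s) || e y s)]]|
    <= 1 + r + r * r.
Proof.
move=> hin; pose P u := [set v | e v u].
have sub : [set x | [exists y, ((y == x) || e x y) && ((y == s) || e y s)]]
    \subset [set s] :|: P s :|: \bigcup_(y in P s) P y.
  apply/subsetP => x; rewrite !inE => /existsP[y /andP[]].
  case/orP => [/eqP -> | exy].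
    by case/orP => [/eqP -> | ->]; rewrite ?eqxx ?orbT.
  case/orP => [/eqP <- | eys]; first by rewrite exy orbT.
  by apply/orP; right; apply/bigcupP; exists y; rewrite inE.
apply: leq_trans (subset_leq_card sub) _.
apply: leq_trans (leq_card_setU _ _) _; apply: leq_add.
  by apply: leq_trans (leq_card_setU _ _) _; rewrite cards1 leq_add2l hin.
by apply: leq_trans (leq_card_bigcup _ hin) _; rewrite leq_mul2r hin orbT.
Qed.

Section PartialColoring.
Variables (T : finType) (r : nat).
Implicit Types (e : rel T) (g : T -> option 'I_r.+1) (j : 'I_r.+1).

Definition acyclic_partial e g : Prop :=
  forall j, acyclic_on e (fun v => g v == Some j).

Definition extends g g' : Prop := forall v j, g v = Some j -> g' v = Some j.

Definition support g : {set T} := [set v | g v != None].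

(** With [e] reversed this describes a $b^-$-vertex, so both kinds share one notion. *)
Definition has_b_vertex e g j : Prop :=
  exists x, g x = Some j /\
    forall j', j' != j -> exists w, e x w /\ g w = Some j'.

Lemma has_b_vertex_extends e g g' j :
  extends g g' -> has_b_vertex e g j -> has_b_vertex e g' j.
Proof.
move=> gg' [x [gx bx]]; exists x; split=> [|j' /bx[w [exw gw]]]; first exact: gg'.
by exists w; split=> //; apply: gg'.
Qed.

Lemma plant_b_vertex e g i :
  irreflexive e ->
  (forall u, #|[set v | e u v]| = r) -> (forall u, #|[set v | e v u]| = r) ->
  acyclic_partial e g -> #|support g| * (1 + r + r * r) < #|T| ->
  exists g', [/\ acyclic_partial e g', extends g g',
    #|support g'| <= #|support g| + r.+1 & has_b_vertex e g' i].
Proof.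
move=> irr hout hin acg small.
pose bad s := [set x | [exists y, ((y == x) || e x y) && ((y == s) || e y s)]].
(* Otherwise the bad sets of the coloured vertices would cover [T], against [small]. *)
have [x xgood] : exists x, x \notin \bigcup_(s in support g) bad s.
  apply/existsP; rewrite -negb_forall; apply/negP => /forallP allbad.
  have := leq_card_bigcup (support g)
    (fun s => @card_two_step_predecessors T e r s (fun u => eq_leq (hin u))).
  have -> : \bigcup_(s in support g) bad s = [set: T].
    by apply/setP => v; rewrite [RHS]inE; exact: allbad.
  by rewrite cardsT leqNgt small.
pose A := x |: [set v | e x v].
have xA : x \in A by rewrite !inE eqxx.
have cA : #|A| = r.+1 by rewrite cardsU1 hout inE irr.
(* Hence the new labels overwrite nothing, and no vertex of [A] has a dart into an old colour
   class. *)
have Afree y : y \in A -> forall s, g s != None -> (y != s) && ~~ e y s.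
  move=> yA s gs; rewrite -negb_or; apply: contra xgood => ys.
  apply/bigcupP; exists s; rewrite inE //; apply/existsP; exists y.
  by move: yA; rewrite !inE => ->.
have [h [hx hinj hsurj]] := rainbow_labelling i cA xA.
have Anone y : y \in A -> g y = None.
  by move=> yA; apply/eqP; apply: contraT => /(Afree y yA); rewrite eqxx.
exists (fun v => if v \in A then Some (h v) else g v); split.
- move=> j; have [y yA hy] := hsurj j.
  (* Since [h] is injective on [A], only [y] joins class [j]; darts inside [A] cannot close a
     monochromatic cycle. *)
  apply: (acyclic_on_add_sink (x := y) (acg j)) => [v||v /eqP gv].
  + case: ifP => // vA /eqP[hv]; case/eqP; apply: hinj => //.
    by rewrite hv hy.
  + by rewrite irr.
  + by have /andP[] : (y != v) && ~~ e y v by apply: Afree; rewrite ?gv.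
- by move=> v j gv; case: ifP => // /Anone; rewrite gv.
- apply: (@leq_trans (#|support g| + #|A|)); last by rewrite cA.
  apply: leq_trans (leq_card_setU _ _).
  apply: subset_leq_card; apply/subsetP => v; rewrite !inE.
  by case: ifP => [|_ ->]; rewrite ?orbT.
- exists x; rewrite xA hx; split=> // j' j'i.
  have [w wA hw] := hsurj j'; exists w; rewrite wA hw; split=> //.
  move: wA; rewrite !inE => /predU1P[wx | //].
  by rewrite -hw wx hx eqxx in j'i.
Qed.

(** The list [s] holds requests, [true] for $b^+$ and [false] for $b^-$. Each colours at most [r.+1]
    further vertices, which keeps the support small enough for the next one. *)
Lemma plant_b_vertices e (s : seq (bool * 'I_r.+1)) :
  irreflexive e ->
  (forall u, #|[set v | e u v]| = r) -> (forall u, #|[set v | e v u]| = r) ->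
  size s * r.+1 * (1 + r + r * r) < #|T| ->
  exists g, [/\ acyclic_partial e g, #|support g| <= size s * r.+1 &
    forall b i, (b, i) \in s ->
      has_b_vertex (fun u v => if b then e u v else e v u) g i].
Proof.
move=> irr hout hin; elim: s => [|[b i] s IHs] /= small.
  exists (fun=> None); split=> //.
  - by move=> j [|v c] //= _ _.
  - by rewrite leqn0 cards_eq0; apply/eqP/setP => v; rewrite !inE.
have [|g [acg cg bg]] := IHs.
  by apply: leq_ltn_trans small; rewrite !leq_mul2r leqnSn !orbT.
have smallg : #|support g| * (1 + r + r * r) < #|T|.
  apply: leq_ltn_trans small; rewrite leq_mul2r (leq_trans cg) ?orbT //.
  by rewrite leq_mul2r leqnSn orbT.
suff [g' [acg' gg' cg' bg']] : exists g', [/\ acyclic_partial e g', extends g g',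
    #|support g'| <= #|support g| + r.+1 &
    has_b_vertex (fun u v => if b then e u v else e v u) g' i].
  exists g'; split=> [//||b' i'].
    by apply: leq_trans cg' _; rewrite mulSn addnC leq_add2l.
  rewrite inE => /predU1P[[-> ->] // | /bg]; exact: has_b_vertex_extends.
case: b; first exact: plant_b_vertex.
(* Reversing all darts swaps [hout] with [hin] and preserves acyclicity. *)
have [|g' [acg' gg' cg' bg']] := plant_b_vertex (e := fun u v => e v u) (g := g) i
  irr hin hout _ smallg; first by move=> j; apply: acyclic_on_rev.
by exists g'; split=> // j; apply: acyclic_on_rev (acg' j).
Qed.

Lemma complete_coloring e g :
  irreflexive e -> (forall u, #|[set v | e u v]| <= r) -> acyclic_partial e g ->
  exists f : T -> 'I_r.+1,
    acyclic_partial e (fun v => Some (f v)) /\ extends g (fun v => Some (f v)).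
Proof.
move=> irr hout; move: {2}#|~: support g| (leqnn #|~: support g|) => n.
elim: n g => [|n IHn] g cn acg.
  have tot v : g v != None.
    move: cn; rewrite leqn0 cards_eq0 => /eqP/setP/(_ v).
    by rewrite !inE => /negbFE.
  (* The default [ord0] is never taken, as [g] is total here. *)
  exists (fun v => odflt ord0 (g v)).
  have E v : Some (odflt ord0 (g v)) = g v by case: (g v) (tot v).
  split=> [j c c0 cyc | v j gv]; last by rewrite E.
  by rewrite (eq_all (a2 := fun v => g v == Some j)) ?acg // => v; rewrite E.
have [v vN | allS] := pickP (mem (~: support g)); last first.
  by apply: IHn => //; rewrite (eq_card0 allS).
have gv : g v = None by move: vN; rewrite !inE negbK => /eqP.
(* Pigeonhole: at most [r] out-neighbours cannot show all [r.+1] colours. Giving [v] a missing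
   colour makes it a sink of its class. *)
have [i inew] : exists i, Some i \notin [seq g w | w in [set w | e v w]].
  apply/existsP; rewrite -negb_forall; apply/negP => /forallP alli.
  suff: r.+1 <= r by rewrite ltnn.
  apply: leq_trans (hout v).
  rewrite -{1}(card_ord r.+1) -(size_image g) cardE -(size_map Some).
  apply: uniq_leq_size; first by rewrite map_inj_uniq ?enum_uniq // => ? ? [].
  by move=> _ /mapP[i _ ->]; exact: alli.
pose g' w := if w == v then Some i else g w.
have gg' : extends g g'.
  by move=> w j gw; rewrite /g'; case: (w =P v) gw => // ->; rewrite gv.
have [||f [acf gf]] := IHn g'.
- rewrite -ltnS; apply: leq_trans cn; apply: proper_card; apply/properP; split.
    by apply/subsetP => w; rewrite !inE !negbK /g'; case: (w =P v).
  by exists v => //; rewrite !inE /g' eqxx.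
- move=> j; have [-> | ji] := eqVneq j i; last first.
    move=> c c0 cyc; apply: contra (acg j c c0 cyc); apply: sub_all => w.
    by rewrite /g'; case: (w =P v) => // _ /eqP[ij]; rewrite ij eqxx in ji.
  apply: (acyclic_on_add_sink (x := v) (acg i)) => [w||w /eqP gw].
  + by rewrite /g'; case: (w =P v).
  + by rewrite irr.
  + by apply: contra inew => vw; apply/imageP; exists w; rewrite ?inE.
by exists f; split=> // w j gw; apply/gf/gg'.
Qed.

End PartialColoring.

(** All colours occur on [u] and its out-neighbours, which yields the upper bound on the
    dib-chromatic number. *)
Lemma bplus_vertex_colors (D : digraph) (k : nat) (f : D -> 'I_k) (u : D) :
  bplus_vertex f u -> k <= (outdeg u).+1.
Proof.
move=> bu; rewrite -{1}(card_ord k) -cardsT.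
apply: (@leq_trans #|f u |: [set f w | w in [set w | dart u w]]|).
  apply: subset_leq_card; apply/subsetP => j _; rewrite !inE.
  have [//| /bu[w [uw <-]]] := eqVneq j (f u).
  by apply/imsetP; exists w; rewrite ?inE.
apply: leq_trans (leq_card_setU _ _) _.
by rewrite cards1 add1n ltnS leq_imset_card.
Qed.

Theorem theorem15 (D : digraph) (r : nat) (hr : 2 <= r)
  (hreg : regular D r) (hcard : 8 * r ^ 4 <= #|D|) :
  is_dib D r.+1.
Proof.
have hout u : #|[set v : D | dart u v]| = r by have [] := hreg u.
have hin u : #|[set v : D | dart v u]| = r by have [] := hreg u.
have irr := @dart_irrefl D.
split; last first.
  move=> [//|k] [f [[_ bf] _]]; have [[u [_]]] := bf ord0.
  by move=> /bplus_vertex_colors; rewrite (hreg u).1.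
pose s := [seq (b, i) | b <- [:: true; false], i <- enum 'I_r.+1].
have ins b i : (b, i) \in s.
  by apply: allpairs_f; [case: b | rewrite mem_enum].
have small : size s * r.+1 * (1 + r + r * r) < #|D|.
  apply: leq_trans hcard; rewrite size_allpairs size_enum_ord /= !expnS expn0.
  (* With [2 * r.+1] requests, this is $2(r+1)^2(1+r+r^2) < 8r^4$; at [r = 2] it reads 126 < 128. *)
  nia.
have [g [acg _ bg]] := plant_b_vertices irr hout hin small.
have [f [acf gf]] := complete_coloring irr (fun u => eq_leq (hout u)) acg.
have bf b i := has_b_vertex_extends gf (bg b i (ins b i)).
exists f; split; last first.
  move=> j [c [[c0 /andP[cyc _]] cj]]; have /negP := acf j c c0 cyc; apply.
  by apply/allP => v /cj ->.
split=> [j | j]; first by have [x [[fx] _]] := bf true j; exists x.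
split; [have [x [[fx] bx]] := bf true j | have [x [[fx] bx]] := bf false j];
  exists x; split=> // j'; rewrite fx => /bx[w [xw [fw]]]; by exists w.
Qed.
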